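(* Let $N$ be a $4\times 3$ matrix of linear forms in $R=K[x_0,\dots,x_r]$ that drops rank on a degree $2$ hypersurface $Q=\{q=0\}$, i.e. the maximal minors of $N$ have a greatest common divisor $q$ of degree $2$, and let $L$ be the linear subspace where $N$ drops rank, residual of $Q$. Then $N=S_iX_i$, where $i=5-\mathrm{codim}(L)\in\{1,2,3\}$ and $S_i$, $X_i$ are as follows. Let $q\,l_j$ ($j=1,\dots,4$), with $l_j$ a linear form, be the minor (with its proper sign) obtained by deleting the $j$-th row of $N$, so that $L=\{l_1=l_2=l_3=l_4=0\}$. \begin{itemize} \item If $\mathrm{codim}(L)=4$ (the $l_j$ are linearly independent), then $i=1$, $$S_1=\begin{pmatrix}0&-l_3&l_2&0&0&l_4\\ l_3&0&-l_1&0&l_4&0\\ -l_2&l_1&0&l_4&0&0\\ 0&0&0&-l_3&-l_2&-l_1\end{pmatrix},$$ and $X_1$ is a maximal rank $6\times 3$ matrix with entries in $K$. \item If $\mathrm{codim}(L)=3$, with $l_1+z_2l_2+z_3l_3+z_4l_4=0$ for scalars $z_j\in K$, then $i=2$, $$S_2=\begin{pmatrix}1&0&0&0\\ z_2&0&-l_4&l_3\\ z_3&l_4&0&-l_2\\ z_4&-l_3&l_2&0\end{pmatrix},$$ and $X_2$ is a maximal rank $4\times 3$ matrix with linear forms on the first row and scalars elsewhere. \item If $\mathrm{codim}(L)=2$, with $l_1+z_{31}l_3+z_{41}l_4=0$ and $l_2+z_{32}l_3+z_{42}l_4=0$ for scalars $z_{ij}\in K$, then $i=3$, $$S_3=\begin{pmatrix}1&0&0\\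 0&1&0\\ z_{31}&z_{32}&-l_4\\ z_{41}&z_{42}&l_3\end{pmatrix},$$ and $X_3$ is a generically maximal rank $3\times 3$ matrix with linear forms on the first two rows and scalars on the last row. \end{itemize}
   Context: $K$ is a field with $\mathrm{char}(K)\neq 2$, $R=K[x_0,\dots,x_r]$. ''Proper sign'' means signs are chosen so that $(l_1,l_2,l_3,l_4)N=0$. $\mathrm{codim}(L)$ is the dimension of the $K$-span of $l_1,\dots,l_4$. In the cases $\mathrm{codim}(L)=3$ and $\mathrm{codim}(L)=2$ the linear relations among the $l_j$ are assumed to be of the displayed form (the rows of $N$ being ordered accordingly), so that $l_2,l_3,l_4$, respectively $l_3,l_4$, are linearly independent. *)

(* Defs.v *)
From HB Require Import structures.
From mathcomp Require Import all_boot all_order all_fingroup all_algebra.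
From mathcomp Require Export mpoly.

Set Implicit Arguments.
Unset Strict Implicit.
Unset Printing Implicit Defensive.

Import GRing.Theory.
Local Open Scope ring_scope.

(* R = K[x_0, ..., x_r] has r.+1 variables.  The linear forms of R, zero
   included, are the K-vector space R_1. *)
Notation polyring K r := {mpoly K[r.+1]} (only parsing).
Notation linform K r := (dhomog r.+1 K 1) (only parsing).

Section Defs.
Variables (K : fieldType) (r : nat).
Local Notation R := (polyring K r).
Local Notation R1 := (linform K r).

Definition linform_mx m n (A : 'M[R1]_(m, n)) : 'M[R]_(m, n) :=
  map_mx (@mpoly_of_dhomog r.+1 K 1) A.

Definition scalar_entries_mx m n (A : 'M[K]_(m, n)) : 'M[R]_(m, n) :=
  map_mx (@mpolyC r.+1 K) A.

Definition mx_of_rows m n (rows : seq (seq R)) : 'M[R]_(m, n) :=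
  \matrix_(i < m, j < n) nth 0 (nth [::] rows i) j.

(* For a 4 x 3 matrix, the maximal minor obtained by deleting row j.  The
   "proper sign" is the one for which the row of signed minors annihilates N
   on the left, see [signed_minor_syzygy]; it is unique up to a global sign. *)
Definition signed_minor (N : 'M[R]_(4, 3)) (j : 'I_4) : R :=
  (-1) ^+ j * \det (row' j N).

Definition mpoly_dvd (d p : R) : Prop := exists c : R, p = c * d.

Definition is_gcd (I : finType) (f : I -> R) (q : R) : Prop :=
  (forall i, mpoly_dvd q (f i)) /\
  (forall d, (forall i, mpoly_dvd d (f i)) -> mpoly_dvd d q).

Definition codim (l1 l2 l3 l4 : R1) : nat := \dim <<[:: l1; l2; l3; l4]>>%VS.

(* Rank over the fraction field K(x_0, ..., x_r), i.e. at the generic point.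
   For a matrix with nonconstant entries "maximal rank" can only mean this:
   the rank may drop at special points. *)
Definition generic_rank m n (A : 'M[R]_(m, n)) : nat :=
  \rank (map_mx (@tofrac R) A).

Definition S1 (l1 l2 l3 l4 : R) : 'M[R]_(4, 6) := mx_of_rows 4 6
  [:: [::   0; - l3;  l2;    0;    0;   l4];
      [::  l3;    0; - l1;   0;   l4;    0];
      [:: - l2;  l1;    0;  l4;    0;    0];
      [::   0;    0;    0; - l3; - l2; - l1]].

Definition S2 (l2 l3 l4 : R) (z2 z3 z4 : K) : 'M[R]_(4, 4) := mx_of_rows 4 4
  [:: [:: 1;          0;    0;    0];
      [:: z2%:MP;     0; - l4;   l3];
      [:: z3%:MP;    l4;    0; - l2];
      [:: z4%:MP;  - l3;   l2;    0]].

Definition S3 (l3 l4 : R) (z31 z32 z41 z42 : K) : 'M[R]_(4, 3) := mx_of_rows 4 3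
  [:: [:: 1;          0;           0];
      [:: 0;          1;           0];
      [:: z31%:MP;    z32%:MP;  - l4];
      [:: z41%:MP;    z42%:MP;    l3]].

Lemma signed_minor_syzygy (N : 'M[R]_(4, 3)) :
  (\row_j signed_minor N j) *m N = 0.
Proof.
apply/rowP => k; rewrite !mxE.
pose M : 'M[R]_(1 + 3) := row_mx (col k N) N.
have dM : \det M = 0.
  rewrite -det_tr; apply: (@determinant_alternate _ _ _ (lshift 3 0) (rshift 1 k)) => //.
  by move=> j; rewrite !mxE (unsplitK (inl _)) (unsplitK (inr _)) /= !mxE.
transitivity (\det M) => //; rewrite (expand_det_col M (lshift 3 0)).
apply: (@eq_bigr _ _ _ 'I_4) => j _; rewrite !mxE (unsplitK (inl _)) /= !mxE mulrC.
congr (_ * _).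
rewrite /signed_minor /cofactor /= addn0; congr (_ * \det _).
apply/matrixP => a b; rewrite !mxE.
have -> : lift (lshift 3 0 : 'I_(1 + 3)) b = rshift 1 b :> 'I_(1 + 3) by apply: val_inj.
by rewrite (unsplitK (inr _)).
Qed.

End Defs.

(* Main.v *)
Require Import Defs.
From mathcomp Require Import all_boot all_order all_fingroup all_algebra.
From mathcomp Require Import ring.

(** The row of signed minors q l_j annihilates N on the left, and q is not zero
since it has degree 2; so every column of N is a syzygy, with linear entries,
of the linear forms l_1, ..., l_4.  The factorizations describe such syzygies.

The key fact is [linear_syzygy]: if l_1, ..., l_k are linearly independent and
sum_i l_i n_i = 0 with n_i linear, then n_i = sum_j A_ij l_j for an alternating
scalar matrix A, i.e. the syzygy is a scalar combination of the Koszul ones.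
The proof evaluates linear forms at points.  Choose p_1, ..., p_k in
affine space dual to the l_i, that is l_j(p_i) = 1 if i = j and 0 otherwise.
Polarizing the relation gives, for all points u and v,
  sum_j (l_j(u) n_j(v) + l_j(v) n_j(u)) = 0,
and u = p_i turns this into n_i(v) = - sum_j n_j(p_i) l_j(v) for all v; so n_i
is a combination of the l_j, and evaluation at the p_i shows that the matrix
n_i(p_j) is alternating.

In codimension 4 this applies to the columns of N as they stand, and the
columns of S_1 are the six Koszul syzygies ([factor_S1]).  In codimension 3 and
2 the relations among the l_j are used to eliminate l_1, respectively l_1 and
l_2.  What is left is a linear syzygy of the remaining independent forms, whose
coefficients are the lower rows of N corrected by scalar multiples of the upper
ones: the first columns of S_2 and S_3 record these corrections, and the last
ones the Koszul syzygies ([factor_S2], [factor_S3]).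

In each case X has generic rank 3 because N = S X has a nonzero maximal minor
([generic_rank_right_factor]).  Finally the codimension is at least 2: if all
l_j were multiples of one linear form v, then q v would be a common divisor of
the minors, hence a divisor of their gcd q, and v would be a unit
([common_divisor_line]). *)

Set Implicit Arguments.
Unset Strict Implicit.
Unset Printing Implicit Defensive.

Import GRing.Theory.
Local Open Scope ring_scope.

(** * Linear forms and their values *)

Lemma linform_coords (K : fieldType) (r : nat) (f : linform K r) :
  f = \sum_a f@_U_(a) *: 'X_a :> polyring K r.
Proof.
apply/mpolyP => m; rewrite raddf_sum /=.
have [m1 | m1] := eqVneq (mdeg m) 1%N.
  have /mdeg1P[a /eqP ->] : mdeg m == 1%N by apply/eqP.
  rewrite (bigD1 a) //= mcoeffZ mcoeffXU eqxx mulr1 big1 ?addr0 // => b ba.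
  by rewrite mcoeffZ mcoeffXU (negbTE ba) mulr0.
rewrite (dhomog_nemf_coeff _ m1) ?dhomog_is_dhomog // big1 // => a _.
rewrite mcoeffZ mcoeffX; case: eqP => [am | _]; last by rewrite mulr0.
by rewrite -am mdeg1 in m1.
Qed.

Lemma meval_linform (K : fieldType) (r : nat) (f : linform K r)
    (v : 'I_r.+1 -> K) :
  meval v f = \sum_a f@_U_(a) * v a.
Proof.
rewrite {1}linform_coords rmorph_sum /=.
by apply: eq_bigr => a _; rewrite mevalZ mevalXU.
Qed.

Lemma meval_linformD (K : fieldType) (r : nat) (f : linform K r)
    (u v : 'I_r.+1 -> K) :
  meval (fun a => u a + v a) f = meval u f + meval v f.
Proof.
rewrite !meval_linform -big_split /=.
by apply: eq_bigr => a _; rewrite mulrDr.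
Qed.

(** Unlike polynomials in general, linear forms are determined by their values
over any field, even a finite one: the coefficients are the values at the
standard basis points. *)
Lemma linform_eq_meval (K : fieldType) (r : nat) (f g : linform K r) :
  (forall v, meval v f = meval v g) -> f = g.
Proof.
move=> fg; apply: val_inj; rewrite /= (linform_coords f) (linform_coords g).
apply: eq_bigr => a _; congr (_ *: _).
have delta (h : linform K r) : meval (fun b => (b == a)%:R) h = h@_U_(a).
  rewrite meval_linform (bigD1 a) //= eqxx mulr1 big1 ?addr0 // => b ba.
  by rewrite (negbTE ba) mulr0.
by rewrite -!delta fg.
Qed.

(** The coefficient matrix of independent forms has a right inverse, whose
columns are the dual points. *)
Lemma dual_points (K : fieldType) (r k : nat) (l : k.-tuple (linform K r)) :
  free l ->
  exists p : 'I_k -> 'I_r.+1 -> K,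
    forall i j, meval (p i) (tnth l j) = (i == j)%:R.
Proof.
move=> /freeP freel.
pose L := \matrix_(i < k, a < r.+1) (tnth l i : polyring K r)@_U_(a).
have /row_freeP[P LP] : row_free L.
  rewrite -kermx_eq0; apply/rowV0P => u /sub_kermxP uL0.
  apply/rowP => i; rewrite mxE; apply: (freel (u 0)).
  apply: val_inj; rewrite /= raddf_sum /= [RHS](linform_coords 0).
  rewrite (eq_bigr (fun i => \sum_a (u 0 i * L i a) *: 'X_a)); last first.
    move=> j _; rewrite linform_coords scaler_sumr.
    by apply: eq_bigr => a _; rewrite scalerA mxE (tnth_nth 0).
  rewrite exchange_big /=; apply: eq_bigr => a _.
  rewrite -scaler_suml mcoeff0; congr (_ *: _).
  by move/rowP/(_ a): uL0; rewrite !mxE.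
exists (fun i a => P a i) => i j; rewrite meval_linform.
move/matrixP/(_ j i): LP; rewrite !mxE eq_sym => <-.
by apply: eq_bigr => a _; rewrite mxE.
Qed.

(** * Linear syzygies of independent linear forms *)

(** The first step of the exactness of the Koszul complex, in its linear strand.
With dual points p_i, the matrix is A_ij = n_i(p_j). *)
Lemma linear_syzygy (K : fieldType) (r k : nat)
    (l n : k.-tuple (linform K r)) :
  free l ->
  \sum_i (tnth l i : polyring K r) * tnth n i = 0 ->
  exists A : 'M[K]_k,
    [/\ forall i, A i i = 0, forall i j, A j i = - A i j
      & forall i, tnth n i = \sum_j A i j *: tnth l j].
Proof.
move=> /dual_points[p pl] ln0.
have evln v : \sum_i meval v (tnth l i) * meval v (tnth n i) = 0.
  rewrite -[RHS](meval0 v) -ln0 raddf_sum.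
  by apply: eq_bigr => i _; rewrite /= mevalM.
have polar u v : \sum_i (meval u (tnth l i) * meval v (tnth n i)
                       + meval v (tnth l i) * meval u (tnth n i)) = 0.
  (* The symmetric bilinear form is the relation at u + v minus those at u and
     at v, and each of the three vanishes. *)
  rewrite -[RHS]subr0 -[X in _ = X - _](subr0 0).
  rewrite -[X in _ = X - _ - _](evln (fun a => u a + v a)).
  rewrite -[X in _ = _ - X - _](evln u) -[X in _ = _ - _ - X](evln v) -!sumrB.
  by apply: eq_bigr => i _; rewrite !meval_linformD; ring.
have pick (w : 'I_k -> K) i : \sum_j meval (p i) (tnth l j) * w j = w i.
  rewrite (bigD1 i) //= pl eqxx mul1r big1 ?addr0 // => j ji.
  by rewrite pl eq_sym (negbTE ji) mul0r.
have polarp i v :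
    meval v (tnth n i) = - \sum_j meval v (tnth l j) * meval (p i) (tnth n j).
  apply/eqP; rewrite -addr_eq0 -[X in X + _](pick (fun j => meval v (tnth n j))).
  by rewrite -big_split /= polar.
exists (\matrix_(i, j) meval (p j) (tnth n i)); split=> [i | i j | i].
- by rewrite mxE -[LHS](pick (fun j => meval (p i) (tnth n j))) evln.
- by rewrite !mxE polarp pick.
apply: linform_eq_meval => v; rewrite polarp !raddf_sum /=.
apply: eq_bigr => j _; rewrite mevalZ mxE.
by rewrite (polarp i (p j)) pick mulrC mulNr.
Qed.

Lemma linear_syzygy_mx (K : fieldType) (r k m : nat)
    (l : k.-tuple (linform K r)) (M : 'M[linform K r]_(k, m)) :
  free l ->
  (forall c, \sum_i (tnth l i : polyring K r) * M i c = 0) ->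
  exists A : 'I_m -> 'M[K]_k,
    forall c, [/\ forall i, A c i i = 0, forall i j, A c j i = - A c i j
      & forall i, M i c = \sum_j A c i j *: tnth l j].
Proof.
move=> free_l lM0; suff colM c : exists A : 'M[K]_k, [/\ forall i, A i i = 0,
    forall i j, A j i = - A i j & forall i, M i c = \sum_j A i j *: tnth l j].
  by have [A AE] := fin_all_exists colM; exists A.
have [| A [A0 AN ME]] := @linear_syzygy _ _ _ l [tuple M i c | i < k] free_l.
  by rewrite -[RHS](lM0 c); apply: eq_bigr => i _; rewrite tnth_mktuple.
by exists A; split=> // i; rewrite -ME tnth_mktuple.
Qed.

(** * Generic rank and common divisors *)

(** Over the field of rational functions, a nonzero maximal minor gives S X rank
3, and the rank of a product is at most that of its right factor. *)
Lemma generic_rank_right_factor (K : fieldType) (r k : nat)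
    (S : 'M[polyring K r]_(4, k)) (X : 'M[polyring K r]_(k, 3)) (j : 'I_4) :
  signed_minor (S *m X) j != 0 -> generic_rank X = 3%N.
Proof.
move=> minor_neq0; apply/eqP; rewrite eqn_leq rank_leq_col /=.
have det_neq0 : \det (row' j (S *m X)) != 0.
  by apply: contraNneq minor_neq0 => d0; rewrite /signed_minor d0 mulr0.
rewrite row'Esub -mul_rowsub_mx in det_neq0.
apply: leq_trans (mxrankM_maxr (map_mx (@tofrac _) (rowsub (lift j) S)) _).
rewrite -map_mxM mxrank_unit // unitmxE det_map_mx unitfE.
by rewrite tofrac_eq0.
Qed.

Lemma generic_rank_scalar (K : fieldType) (r m n : nat) (A : 'M[K]_(m, n)) :
  generic_rank (scalar_entries_mx r A) = \rank A.
Proof. by rewrite /generic_rank /scalar_entries_mx -map_mx_comp mxrank_map. Qed.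

(** Eliminating from a family vectors that depend on the remaining ones leaves a
family of the same span, hence independent as soon as its size is the dimension
of that span. *)
Lemma span_tail_free (K : fieldType) (vT : vectType K) (s t : seq vT) :
  {subset s <= <<t>>%VS} -> \dim <<s ++ t>> = size t -> free t.
Proof.
move=> st; rewrite /free span_cat => <-; apply/eqP; congr (\dim _).
by apply/esym/addv_idPr/span_subvP.
Qed.

(** If all the f_i / q were multiples of the linear form v, then q v would divide
every f_i, hence q.  This is impossible for q nonzero, because v vanishes at the
origin and so is not a unit. *)
Lemma common_divisor_line (K : fieldType) (r : nat) (I : finType)
    (f : I -> polyring K r) (q : polyring K r) (l : I -> linform K r)
    (v : linform K r) :
  is_gcd f q -> (forall i, f i = q * l i) -> (forall i, l i \in <[v]>%VS) ->
  q = 0.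
Proof.
move=> [_ gcd] fE lv.
have [i | c qE] := gcd (q * v).
  have /vlineP[c lE] := lv i.
  by exists c%:MP; rewrite fE lE /= mul_mpolyC scalerAr.
have [//|q_neq0] := eqVneq q 0.
have : c * v = 1 by apply: (mulfI q_neq0); rewrite mulr1 [RHS]qE; ring.
move/(congr1 (meval (fun _ => 0))); rewrite mevalM meval1 meval_linform.
rewrite big1 => [| a _]; last by rewrite mulr0.
by rewrite mulr0 => /esym/eqP; rewrite oner_eq0.
Qed.

(** * The three factorizations *)

Lemma sum_ord2 (V : nmodType) (F : 'I_2 -> V) : \sum_i F i = F 0 + F 1.
Proof.
by rewrite !big_ord_recl big_ord0 addr0; congr (_ + F _); apply: val_inj.
Qed.

Lemma sum_ord3 (V : nmodType) (F : 'I_3 -> V) : \sum_i F i = F 0 + F 1 + F 2.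
Proof.
rewrite !big_ord_recl big_ord0 addr0 addrA.
by congr (_ + F _ + F _); apply: val_inj.
Qed.

Lemma sum_ord4 (V : nmodType) (F : 'I_4 -> V) :
  \sum_i F i = F 0 + F 1 + F 2 + F 3.
Proof.
rewrite !big_ord_recl big_ord0 addr0 !addrA.
by congr (_ + F _ + F _ + F _); apply: val_inj.
Qed.

Lemma ord4_ind (P : 'I_4 -> Prop) : P 0 -> P 1 -> P 2 -> P 3 -> forall i, P i.
Proof.
move=> P0 P1 P2 P3; case=> [[|[|[|[|//]]]]] i_lt4.
- by rewrite (_ : Ordinal i_lt4 = 0) //; apply: val_inj.
- by rewrite (_ : Ordinal i_lt4 = 1) //; apply: val_inj.
- by rewrite (_ : Ordinal i_lt4 = 2) //; apply: val_inj.
- by rewrite (_ : Ordinal i_lt4 = 3) //; apply: val_inj.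
Qed.

(** Each column of S_1 is the Koszul syzygy of a pair l_i, l_j, so column c of X
lists the entries above the diagonal of the alternating matrix of column c of N,
reordered and, for the pair (l_1, l_3), with the opposite sign. *)
Lemma factor_S1 (K : fieldType) (r m : nat) (l1 l2 l3 l4 : linform K r)
    (N : 'M[linform K r]_(4, m)) :
  free [:: l1; l2; l3; l4] ->
  (forall c, (l1 : polyring K r) * N 0 c + (l2 : polyring K r) * N 1 c
             + (l3 : polyring K r) * N 2 c + (l4 : polyring K r) * N 3 c = 0) ->
  exists X : 'M[K]_(6, m),
    linform_mx N = S1 l1 l2 l3 l4 *m scalar_entries_mx r X.
Proof.
move=> free_l lN0.
have [| A AE] := @linear_syzygy_mx _ _ _ _ [tuple l1; l2; l3; l4] N free_l.
  by move=> c; rewrite sum_ord4 !(tnth_nth 0); apply: lN0.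
exists (\matrix_(i, c) nth 0
  [:: A c 1 2; A c 2 0; A c 0 1; A c 2 3; A c 1 3; A c 0 3] i).
apply/matrixP => i c; have [A0 AN NE] := AE c.
rewrite [LHS]mxE NE sum_ord4 mxE !big_ord_recl big_ord0 !mxE !(tnth_nth 0) /=.
rewrite -!mul_mpolyC; move: i; apply: ord4_ind => /=; rewrite ?A0.
- by rewrite (AN 0 2) !rmorphN /=; ring.
- by rewrite (AN 0 1) !rmorphN /=; ring.
- by rewrite (AN 1 2) !rmorphN /=; ring.
by rewrite (AN 0 3) (AN 1 3) (AN 2 3) !rmorphN /=; ring.
Qed.

(** Substituting l_1 in the relation gives
  sum_(j >= 2) l_j (n_j - z_j n_1) = 0,
a linear syzygy of the independent forms l_2, l_3, l_4.  Its
coefficients are the lower rows of N minus z_j times the first row, which is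
why the first row of N reappears as the row of linear forms of X_2. *)
Lemma factor_S2 (K : fieldType) (r m : nat) (l2 l3 l4 : linform K r)
    (z2 z3 z4 : K) (N : 'M[linform K r]_(4, m)) :
  let l1 := - (z2 *: l2 + z3 *: l3 + z4 *: l4) in
  free [:: l2; l3; l4] ->
  (forall c, (l1 : polyring K r) * N 0 c + (l2 : polyring K r) * N 1 c
             + (l3 : polyring K r) * N 2 c + (l4 : polyring K r) * N 3 c = 0) ->
  exists (a : 'M[linform K r]_(1, m)) (B : 'M[K]_(3, m)),
    linform_mx N = S2 l2 l3 l4 z2 z3 z4
                   *m col_mx (linform_mx a) (scalar_entries_mx r B).
Proof.
move=> l1 free_l lN0.
pose M := \matrix_(i < 3, c < m) nth 0
  [:: N 1 c - z2 *: N 0 c; N 2 c - z3 *: N 0 c; N 3 c - z4 *: N 0 c] i.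
have [| A AE] := @linear_syzygy_mx _ _ _ _ [tuple l2; l3; l4] M free_l.
  move=> c; rewrite sum_ord3 !mxE !(tnth_nth 0) -[RHS](lN0 c) /=.
  by rewrite -!mul_mpolyC; ring.
exists (\row_c N 0 c), (\matrix_(i, c) nth 0 [:: A c 1 2; A c 2 0; A c 0 1] i).
apply/matrixP => i c; have [A0 AN ME] := AE c.
rewrite [LHS]mxE mxE (@big_split_ord _ _ _ 1 3) big_ord1 sum_ord3.
rewrite !(@col_mxEu _ 1 3) !(@col_mxEd _ 1 3) !mxE /=.
move: i; apply: ord4_ind => /=; first by ring.
- move/eqP: (ME 0); rewrite sum_ord3 !(tnth_nth 0) mxE /= subr_eq => /eqP ->.
  by rewrite /= -!mul_mpolyC A0 (AN 0 2) !rmorphN /=; ring.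
- move/eqP: (ME 1); rewrite sum_ord3 !(tnth_nth 0) mxE /= subr_eq => /eqP ->.
  by rewrite /= -!mul_mpolyC A0 (AN 0 1) !rmorphN /=; ring.
move/eqP: (ME 2); rewrite sum_ord3 !(tnth_nth 0) mxE /= subr_eq => /eqP ->.
by rewrite /= -!mul_mpolyC A0 (AN 1 2) (AN 0 2) !rmorphN /=; ring.
Qed.

(** Substituting l_1 and l_2 in the relation gives
  sum_(j >= 3) l_j (n_j - z_j1 n_1 - z_j2 n_2) = 0,
and a linear syzygy of l_3, l_4 is a scalar multiple of (- l_4, l_3). *)
Lemma factor_S3 (K : fieldType) (r m : nat) (l3 l4 : linform K r)
    (z31 z32 z41 z42 : K) (N : 'M[linform K r]_(4, m)) :
  let l1 := - (z31 *: l3 + z41 *: l4) in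
  let l2 := - (z32 *: l3 + z42 *: l4) in
  free [:: l3; l4] ->
  (forall c, (l1 : polyring K r) * N 0 c + (l2 : polyring K r) * N 1 c
             + (l3 : polyring K r) * N 2 c + (l4 : polyring K r) * N 3 c = 0) ->
  exists (A : 'M[linform K r]_(2, m)) (b : 'M[K]_(1, m)),
    linform_mx N = S3 l3 l4 z31 z32 z41 z42
                   *m col_mx (linform_mx A) (scalar_entries_mx r b).
Proof.
move=> l1 l2 free_l lN0.
pose M := \matrix_(i < 2, c < m) nth 0
  [:: N 2 c - z31 *: N 0 c - z32 *: N 1 c; N 3 c - z41 *: N 0 c - z42 *: N 1 c] i.
have [| A AE] := @linear_syzygy_mx _ _ _ _ [tuple l3; l4] M free_l.
  move=> c; rewrite sum_ord2 !mxE !(tnth_nth 0) -[RHS](lN0 c) /=.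
  by rewrite -!mul_mpolyC; ring.
exists (\matrix_(i, c) nth 0 [:: N 0 c; N 1 c] i), (\row_c A c 1 0).
apply/matrixP => i c; have [A0 AN ME] := AE c.
rewrite [LHS]mxE mxE (@big_split_ord _ _ _ 2 1) big_ord1 sum_ord2.
rewrite !(@col_mxEu _ 2 1) !(@col_mxEd _ 2 1) !mxE /=.
move: i; apply: ord4_ind => /=; [by ring | by ring | |].
- move/eqP: (ME 0); rewrite sum_ord2 !(tnth_nth 0) mxE /= !subr_eq => /eqP ->.
  by rewrite /= -!mul_mpolyC A0 (AN 0 1) !rmorphN /=; ring.
move/eqP: (ME 1); rewrite sum_ord2 !(tnth_nth 0) mxE /= !subr_eq => /eqP ->.
by rewrite /= -!mul_mpolyC A0; ring.
Qed.

(** * The structure theorem *)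

Theorem theorem2p2 (K : fieldType) (char_neq2 : 2%N \notin [pchar K]) (r : nat)
    (N : 'M[linform K r]_(4, 3)) (q : polyring K r)
    (q_gcd : is_gcd (fun j : 'I_4 => signed_minor (linform_mx N) j) q)
    (q_deg2 : msize q = 3%N)
    (l1 l2 l3 l4 : linform K r)
    (minorsE : forall j : 'I_4,
       signed_minor (linform_mx N) j
         = q * mpoly_of_dhomog (nth 0 [:: l1; l2; l3; l4] j)) :
  [/\ (5 - codim l1 l2 l3 l4)%N \in [:: 1; 2; 3]%N,
      codim l1 l2 l3 l4 = 4%N ->
        exists2 X1 : 'M[K]_(6, 3),
          \rank X1 = 3%N
          & linform_mx N = S1 l1 l2 l3 l4 *m scalar_entries_mx r X1,
      codim l1 l2 l3 l4 = 3%N ->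
        forall z2 z3 z4 : K,
        l1 + z2 *: l2 + z3 *: l3 + z4 *: l4 = 0 ->
        exists (a : 'M[linform K r]_(1, 3)) (B : 'M[K]_(3, 3)),
          let X2 : 'M[polyring K r]_(4, 3) :=
            col_mx (linform_mx a) (scalar_entries_mx r B) in
          generic_rank X2 = 3%N /\
          linform_mx N = S2 l2 l3 l4 z2 z3 z4 *m X2
    & codim l1 l2 l3 l4 = 2%N ->
        forall z31 z32 z41 z42 : K,
        l1 + z31 *: l3 + z41 *: l4 = 0 ->
        l2 + z32 *: l3 + z42 *: l4 = 0 ->
        exists (A : 'M[linform K r]_(2, 3)) (b : 'M[K]_(1, 3)),
          let X3 : 'M[polyring K r]_(3, 3) :=
            col_mx (linform_mx A) (scalar_entries_mx r b) in
          generic_rank X3 = 3%N /\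
          linform_mx N = S3 l3 l4 z31 z32 z41 z42 *m X3].
Proof.
have q_neq0 : q != 0 by apply: contra_eq_neq q_deg2 => ->; rewrite msize0.
have span_not_line (v : linform K r) : ~~ (<<[:: l1; l2; l3; l4]>> <= <[v]>)%VS.
  apply: contraNN q_neq0 => /subvP sub_line; apply/eqP.
  apply: (common_divisor_line q_gcd minorsE (v := v)) => j.
  by apply/sub_line/memv_span/mem_nth; case: j.
have [j minor_neq0] : exists j, signed_minor (linform_mx N) j != 0.
  have [/existsP // | /existsPn minors0] :=
    boolP [exists j, signed_minor (linform_mx N) j != 0].
  case/negP: (span_not_line 0); apply/span_subvP => f /(nthP 0)[i lt_i4 <-].
  have := minors0 (Ordinal lt_i4); rewrite negbK minorsE mulf_eq0 (negbTE q_neq0).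
  by move=> /eqP l0; rewrite (_ : nth _ _ _ = 0) ?mem0v //; apply: val_inj.
have generic_rank3 k (S : 'M_(4, k)) X :
    linform_mx N = S *m X -> generic_rank X = 3%N.
  by move=> NE; apply: (@generic_rank_right_factor _ _ _ S _ j); rewrite -NE.
have syz c : (l1 : polyring K r) * N 0 c + (l2 : polyring K r) * N 1 c
             + (l3 : polyring K r) * N 2 c + (l4 : polyring K r) * N 3 c = 0.
  have /rowP/(_ c) := signed_minor_syzygy (linform_mx N).
  rewrite !mxE; under eq_bigr do rewrite !mxE minorsE -mulrA.
  move/eqP; rewrite -mulr_sumr mulf_eq0 (negbTE q_neq0) /= => /eqP.
  by rewrite sum_ord4.
split.
- have codim_le4 : (codim l1 l2 l3 l4 <= 4)%N by apply: dim_span.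
  have codim_gt1 : (1 < codim l1 l2 l3 l4)%N.
    (* A span of dimension at most 1 is generated by [vpick], which is 0 when
       the span is. *)
    rewrite ltnNge /codim; set U := <<_>>%VS.
    apply: contra (span_not_line (vpick U)) => U_le1; rewrite -/U.
    have line_sub : (<[vpick U]> <= U)%VS by rewrite -memvE memv_pick.
    suff /eqP -> : (<[vpick U]> == U)%VS by rewrite subvv.
    rewrite eqEdim line_sub dim_vline vpick0 /=.
    by have [->| U_neq0] := eqVneq U 0%VS; rewrite ?dimv0.
  by move: codim_le4 codim_gt1; case: (codim _ _ _ _) => [|[|[|[|[|]]]]].
- move=> /eqP free_l; have [X1 NE] := factor_S1 free_l syz.
  by exists X1; rewrite // -(generic_rank_scalar r); apply: generic_rank3 NE.
- move=> codim3 z2 z3 z4 l1E.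
  have {}l1E : l1 = - (z2 *: l2 + z3 *: l3 + z4 *: l4).
    by apply/eqP; rewrite -addr_eq0 !addrA l1E.
  have free_l : free [:: l2; l3; l4].
    apply: (@span_tail_free _ _ [:: l1]) => // f; rewrite inE => /eqP ->.
    by rewrite l1E memvN !memvD ?memvZ ?memv_span // !inE eqxx ?orbT.
  rewrite l1E in syz.
  have [a [B NE]] := factor_S2 free_l syz.
  by exists a, B; split=> //; apply: generic_rank3 NE.
move=> codim2 z31 z32 z41 z42 l1E l2E.
have {}l1E : l1 = - (z31 *: l3 + z41 *: l4).
  by apply/eqP; rewrite -addr_eq0 !addrA l1E.
have {}l2E : l2 = - (z32 *: l3 + z42 *: l4).
  by apply/eqP; rewrite -addr_eq0 !addrA l2E.
have free_l : free [:: l3; l4].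
  apply: (@span_tail_free _ _ [:: l1; l2]) => // f.
  rewrite !inE => /orP[] /eqP ->; rewrite ?l1E ?l2E.
    by rewrite memvN memvD ?memvZ ?memv_span // !inE eqxx ?orbT.
  by rewrite memvN memvD ?memvZ ?memv_span // !inE eqxx ?orbT.
rewrite l1E l2E in syz.
have [A [b NE]] := factor_S3 free_l syz.
by exists A, b; split=> //; apply: generic_rank3 NE.
Qed.
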